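(* Let $\mathcal R_{\mathrm{LA}}^{\mathrm{sym}}:=\dfrac{\rho\beta+\eta\delta}{\mu(\eta+\rho)}$ and $$Q(P):=4\beta\delta P^2+2\bigl[\beta(\rho-\delta)+\delta(\eta+\mu)\bigr]P+\mu(\eta+\rho)-(\rho\beta+\eta\delta).$$ If $\mathcal R_{\mathrm{LA}}^{\mathrm{sym}}<1$ and the quadratic equation $Q(P)=0$ has a root in $(0,\tfrac12)$, then the radical-free equilibrium $E_0^{\mathrm{sym}}=\bigl(0,\tfrac{\eta}{\eta+\rho}\bigr)$ of the planar system $$\dot P=P\bigl[(\beta-\mu)-2\beta P+(\delta-\beta)A\bigr],\qquad \dot A=\eta(1-2P-A)-(2\delta P+\rho)A$$ on $\mathcal F=\{(P,A)\in\mathbb R^2:P\ge0,\ A\ge0,\ 2P+A\le1\}$ is locally asymptotically stable but not globally attractive on $\mathcal F$. In particular, the threshold $\mathcal R_{\mathrm{LA}}^{\mathrm{sym}}=1$ does not yield a global one-regime classification for the frozen symmetric dynamics.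
   Context: The parameters $\mu,\delta,\eta,\rho>0$ are constants and $\beta=\alpha+\gamma$ with constants $\alpha,\gamma>0$. The frozen symmetric dynamics are those of the constant-parameter, left--right symmetric model $$\dot L=(\alpha C+\delta A-\mu)L+\gamma CR,\qquad \dot R=\gamma CL+(\alpha C+\delta A-\mu)R,\qquad \dot A=\eta C-\delta A(L+R)-\rho A,$$ with $C=1-L-R-A$, on the simplex $\{L\ge0,\ R\ge0,\ A\ge0,\ L+R+A\le1\}$; the planar system is its restriction to the forward invariant diagonal $L=R=P$. The triangle $\mathcal F$ is forward invariant for the planar system. The equilibrium $E_0^{\mathrm{sym}}$ is called radical-free because $P=0$ there. An equilibrium is globally attractive on $\mathcal F$ if every solution starting in $\mathcal F$ converges to it as $t\to\infty$. *)

(* Defs.v *)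
From Stdlib Require Import Reals.
From Coquelicot Require Import Coquelicot.
Open Scope R_scope.

(* [x] solves [x' = f x] on [[0, T)].  Continuity at 0 together with the
   equation on (0, T) is equivalent to asking for the one-sided derivative at 0
   as well, since the right-hand sides below are continuous. *)
Definition solution {V : NormedModule R_AbsRing}
    (f : V -> V) (T : Rbar) (x : R -> V) : Prop :=
  filterlim x (at_right 0) (locally (x 0)) /\
  forall t : R, 0 < t -> Rbar_lt t T -> is_derive x t (f (x t)).

Definition is_equilibrium {V : NormedModule R_AbsRing}
    (f : V -> V) (E : V) : Prop :=
  f E = zero.

Definition converges_to {V : NormedModule R_AbsRing}
    (x : R -> V) (E : V) : Prop :=
  filterlim x (Rbar_locally p_infty) (locally E).

(* Quantifying over every horizon [T], finite or not, also covers solutions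
   that are not a priori global. *)
Definition lyapunov_stable {V : NormedModule R_AbsRing}
    (f : V -> V) (E : V) : Prop :=
  forall eps : posreal, exists d : posreal,
    forall (T : Rbar) (x : R -> V), solution f T x -> ball E d (x 0) ->
      forall t : R, 0 <= t -> Rbar_lt t T -> ball E eps (x t).

Definition locally_attractive {V : NormedModule R_AbsRing}
    (f : V -> V) (E : V) : Prop :=
  exists d : posreal,
    forall x : R -> V, solution f p_infty x -> ball E d (x 0) ->
      converges_to x E.

Definition locally_asymptotically_stable {V : NormedModule R_AbsRing}
    (f : V -> V) (E : V) : Prop :=
  is_equilibrium f E /\ lyapunov_stable f E /\ locally_attractive f E.

Definition globally_attractive {V : NormedModule R_AbsRing}
    (f : V -> V) (X : V -> Prop) (E : V) : Prop :=
  forall x : R -> V, solution f p_infty x -> X (x 0) -> converges_to x E.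

Definition symmetric_field (mu delta eta rho alpha gamma : R)
    (x : R * R * R) : R * R * R :=
  let '(l, r, a) := x in
  let c := 1 - l - r - a in
  ((alpha * c + delta * a - mu) * l + gamma * c * r,
   gamma * c * l + (alpha * c + delta * a - mu) * r,
   eta * c - delta * a * (l + r) - rho * a).

Definition simplex (x : R * R * R) : Prop :=
  let '(l, r, a) := x in 0 <= l /\ 0 <= r /\ 0 <= a /\ l + r + a <= 1.

Definition planar_field (mu delta eta rho beta : R) (x : R * R) : R * R :=
  let '(p, a) := x in
  (p * ((beta - mu) - 2 * beta * p + (delta - beta) * a),
   eta * (1 - 2 * p - a) - (2 * delta * p + rho) * a).

Definition planar_simplex (x : R * R) : Prop :=
  let '(p, a) := x in 0 <= p /\ 0 <= a /\ 2 * p + a <= 1.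

Definition R_LA_sym (mu delta eta rho beta : R) : R :=
  (rho * beta + eta * delta) / (mu * (eta + rho)).

Definition Q (mu delta eta rho beta P : R) : R :=
  4 * beta * delta * P ^ 2
  + 2 * (beta * (rho - delta) + delta * (eta + mu)) * P
  + mu * (eta + rho) - (rho * beta + eta * delta).

Definition E0_sym (eta rho : R) : R * R := (0, eta / (eta + rho)).

(* One regime below the threshold: whenever [R_LA_sym < 1], all solutions in
   the simplex share the same limit, which is not even required to be the
   radical-free equilibrium. *)
Definition one_regime_classification : Prop :=
  forall mu delta eta rho alpha gamma : R,
    0 < mu -> 0 < delta -> 0 < eta -> 0 < rho -> 0 < alpha -> 0 < gamma ->
    R_LA_sym mu delta eta rho (alpha + gamma) < 1 ->
    exists E : R * R * R,
      globally_attractive (symmetric_field mu delta eta rho alpha gamma)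
        simplex E.

(* Main.v *)
Require Import Defs.
From Stdlib Require Import Reals.
From Coquelicot Require Import Coquelicot.
From Stdlib Require Import Lra.
Open Scope R_scope.

(** Local stability.  With [A0 = eta / (eta + rho)] and [b = A - A0] the planar
    system becomes
      [P' = P (- m - 2 beta P + (delta - beta) b)],
      [b' = - (eta + rho) b - 2 (eta + delta A0) P - 2 delta P b],
    where [m (eta + rho) = mu (eta + rho) - (rho beta + eta delta)], so that
    [R_LA_sym < 1] means [0 < m].  The linear part is triangular, and for [K]
    large enough [V = K P ^ 2 + b ^ 2] satisfies [V' <= - lam V] as long as
    [V < v0], for some [lam, v0 > 0] ([triangular_quadratic_lyapunov]).  A
    solution with [V < v0] at time 0 stays in this sublevel set, and [V] decays
    exponentially along it ([sublevel_exponential_decay]).  The argument takes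
    place in a full neighbourhood of the equilibrium, with no sign condition on
    [P] or [A].

    Failure of global attraction.  Setting [P' = 0] with [P <> 0] and
    [A = eta (1 - 2 P) / (eta + rho + 2 delta P)] (from [A' = 0]) gives exactly
    [Q P = 0].  A root of [Q] in (0, 1/2) thus yields a second equilibrium, which
    lies in the simplex ([endemic_equilibrium_of_root]).  The constant solution
    there does not converge to [E0_sym].  Both equilibria lift to the diagonal of
    the symmetric system, whose solutions therefore have no common limit.  An
    explicit choice of parameters meeting the hypotheses refutes the one-regime
    classification. *)

(** * Scalar differential inequalities *)

Lemma le_initial_of_derive_nonpos (f df : R -> R) (T : Rbar) :
  filterlim f (at_right 0) (locally (f 0)) ->
  (forall t, 0 < t -> Rbar_lt t T -> is_derive f t (df t)) ->
  (forall t, 0 < t -> Rbar_lt t T -> df t <= 0) ->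
  forall t, 0 <= t -> Rbar_lt t T -> f t <= f 0.
Proof.
  intros Hc Hd Hle t Ht HtT.
  destruct (Req_dec t 0) as [-> | Ht0]; [lra|].
  assert (Hsub : forall s, s <= t -> Rbar_lt s T).
  { intros s Hs. apply (Rbar_le_lt_trans s t T); [exact Hs | exact HtT]. }
  assert (Hmon : forall s, 0 < s -> s < t -> f t <= f s).
  { intros s Hs Hst.
    destruct (MVT_gen f s t df) as [c [Hc1 Hc2]].
    - intros u. rewrite Rmin_left, Rmax_right by lra. intros Hu.
      apply Hd; [lra | apply Hsub; lra].
    - intros u. rewrite Rmin_left, Rmax_right by lra. intros Hu.
      apply continuity_pt_filterlim, (ex_derive_continuous f u).
      exists (df u). apply Hd; [lra | apply Hsub; lra].
    - rewrite Rmin_left, Rmax_right in Hc1 by lra.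
      assert (df c <= 0) by (apply Hle; [lra | apply Hsub; lra]).
      nra. }
  (* [f] need not be continuous from the left at 0, hence the passage to the
     limit [s -> 0+] instead of the mean value theorem on [[0, t]]. *)
  apply (filterlim_le (F := at_right 0) (fun _ => f t) f (f t) (f 0)).
  - exists (mkposreal t ltac:(lra)). intros s Hs Hs0.
    apply Hmon; [exact Hs0|].
    unfold ball in Hs; simpl in Hs.
    unfold AbsRing_ball, abs, minus, plus, opp in Hs; simpl in Hs.
    apply Rabs_def2 in Hs. lra.
  - apply filterlim_const.
  - exact Hc.
Qed.

Lemma is_derive_sqr_Rmax_0 (y : R) :
  is_derive (fun z => Rmax 0 z ^ 2) y (2 * Rmax 0 y).
Proof.
  destruct (Rtotal_order y 0) as [Hy | [-> | Hy]].
  - apply (is_derive_ext_loc (fun _ => 0)).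
    + apply (filter_imp (fun z => z < 0)); [|apply (open_lt 0 y Hy)].
      intros z Hz. rewrite Rmax_left by lra. simpl. now rewrite Rmult_0_l.
    + rewrite Rmax_left by lra. rewrite Rmult_0_r. apply (is_derive_const 0 y).
  - rewrite Rmax_left by lra. apply is_derive_Reals.
    intros eps Heps. exists (mkposreal eps Heps). simpl.
    intros h Hh Habs. rewrite Rplus_0_l.
    rewrite (Rmax_left 0 0) by lra.
    destruct (Rle_lt_dec h 0).
    + rewrite Rmax_left by lra.
      replace (_ - _) with 0 by (field; exact Hh). rewrite Rabs_R0. exact Heps.
    + rewrite Rmax_right by lra.
      replace (_ - _) with h by (field; exact Hh). exact Habs.
  - apply (is_derive_ext_loc (fun z => z ^ 2)).
    + apply (filter_imp (fun z => 0 < z)); [|apply (open_gt 0 y Hy)].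
      intros z Hz. rewrite Rmax_right by lra. reflexivity.
    + rewrite Rmax_right by lra. auto_derive; [exact I | ring].
Qed.

(** The inequality [dv t <= 0] is only known below the level [v0].  That [v] never
    reaches [v0] follows without a first exit time: [max (0, v0 - v) ^ 2] is
    differentiable and nondecreasing along the whole interval, since its
    derivative vanishes wherever [v0 <= v]. *)
Lemma sublevel_trapping (v dv : R -> R) (v0 : R) (T : Rbar) :
  filterlim v (at_right 0) (locally (v 0)) ->
  (forall t, 0 < t -> Rbar_lt t T -> is_derive v t (dv t)) ->
  (forall t, 0 < t -> Rbar_lt t T -> v t < v0 -> dv t <= 0) ->
  v 0 < v0 ->
  forall t, 0 <= t -> Rbar_lt t T -> v t <= v 0.
Proof.
  intros Hc Hd Hle H0 t Ht HtT.
  set (phi := fun y => - Rmax 0 (v0 - y) ^ 2).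
  assert (Hphi : forall y, is_derive phi y (2 * Rmax 0 (v0 - y))).
  { intros y.
    assert (H : is_derive (fun z => Rmax 0 (v0 - z) ^ 2) y
                  (scal (-1) (2 * Rmax 0 (v0 - y)))).
    { apply (is_derive_comp (fun z => Rmax 0 z ^ 2) (fun z => v0 - z)).
      - apply is_derive_sqr_Rmax_0.
      - auto_derive; [exact I | ring]. }
    apply (is_derive_opp _ y) in H.
    replace (2 * Rmax 0 (v0 - y)) with (opp (scal (-1) (2 * Rmax 0 (v0 - y))));
      [exact H|].
    unfold opp, scal; simpl; unfold mult; simpl; ring. }
  assert (Hmon : phi (v t) <= phi (v 0)).
  { apply (le_initial_of_derive_nonpos (fun s => phi (v s))
             (fun s => dv s * (2 * Rmax 0 (v0 - v s))) T); try assumption.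
    - apply (filterlim_comp _ _ _ v phi _ (locally (v 0))); [exact Hc|].
      apply (ex_derive_continuous phi). eexists; apply Hphi.
    - intros s Hs HsT. apply (is_derive_comp phi v); [apply Hphi | now apply Hd].
    - intros s Hs HsT. destruct (Rlt_le_dec (v s) v0) as [Hlt | Hge].
      + rewrite Rmax_right by lra. specialize (Hle s Hs HsT Hlt). nra.
      + rewrite Rmax_left by lra. lra. }
  unfold phi in Hmon. rewrite (Rmax_right 0 (v0 - v 0)) in Hmon by lra.
  destruct (Rle_lt_dec (v0 - v t) 0).
  - rewrite Rmax_left in Hmon by lra. nra.
  - rewrite Rmax_right in Hmon by lra. nra.
Qed.

Lemma sublevel_exponential_decay (v dv : R -> R) (v0 lam : R) (T : Rbar) :
  0 <= lam -> (forall t, 0 <= v t) ->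
  filterlim v (at_right 0) (locally (v 0)) ->
  (forall t, 0 < t -> Rbar_lt t T -> is_derive v t (dv t)) ->
  (forall t, 0 < t -> Rbar_lt t T -> v t < v0 -> dv t <= - lam * v t) ->
  v 0 < v0 ->
  forall t, 0 <= t -> Rbar_lt t T -> v t <= v 0 * exp (- lam * t).
Proof.
  intros Hlam Hpos Hc Hd Hle H0 t Ht HtT.
  assert (Htrap : forall s, 0 <= s -> Rbar_lt s T -> v s <= v 0).
  { apply (sublevel_trapping v dv v0 T); try assumption.
    intros s Hs HsT Hlt. specialize (Hle s Hs HsT Hlt). specialize (Hpos s). nra. }
  assert (Hexp : forall s, is_derive (fun u => exp (lam * u)) s (lam * exp (lam * s))).
  { intros s. auto_derive; [exact I | ring]. }
  assert (Hmon : v t * exp (lam * t) <= v 0 * exp (lam * 0)).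
  { apply (le_initial_of_derive_nonpos (fun s => v s * exp (lam * s))
             (fun s => dv s * exp (lam * s) + v s * (lam * exp (lam * s))) T);
      try assumption.
    - apply (filterlim_comp_2 (G := locally (v 0)) (H := locally (exp (lam * 0)))
               v (fun s => exp (lam * s)) Rmult).
      + exact Hc.
      + apply (filterlim_filter_le_1 (F := locally 0)).
        * apply filter_le_within.
        * apply (ex_derive_continuous (fun u => exp (lam * u)) 0).
          eexists; apply Hexp.
      + apply (filterlim_mult (K := R_AbsRing) (v 0) (exp (lam * 0))).
    - intros s Hs HsT.
      apply (is_derive_mult v (fun u => exp (lam * u)) s);
        [now apply Hd | apply Hexp | intros; apply Rmult_comm].
    - intros s Hs HsT.
      assert (v s < v0) by (pose proof (Htrap s ltac:(lra) HsT); lra).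
      specialize (Hle s Hs HsT H). pose proof (exp_pos (lam * s)). nra. }
  rewrite Rmult_0_r, exp_0, Rmult_1_r in Hmon.
  replace (- lam * t) with (- (lam * t)) by ring. rewrite exp_Ropp.
  pose proof (exp_pos (lam * t)).
  apply (Rmult_le_reg_r (exp (lam * t))); [assumption|].
  rewrite Rmult_assoc, Rinv_l by lra. lra.
Qed.

(** * Solutions in a product, and constant solutions *)

Lemma is_derive_fst {U V : NormedModule R_AbsRing} (x : R -> U * V) (t : R)
    (l : U * V) :
  is_derive x t l -> is_derive (fun s => fst (x s)) t (fst l).
Proof.
  intros H.
  apply (filterdiff_comp' x (@fst U V) t (fun y => scal y l) (@fst U V)); [exact H|].
  apply filterdiff_linear, is_linear_fst.
Qed.

Lemma is_derive_snd {U V : NormedModule R_AbsRing} (x : R -> U * V) (t : R)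
    (l : U * V) :
  is_derive x t l -> is_derive (fun s => snd (x s)) t (snd l).
Proof.
  intros H.
  apply (filterdiff_comp' x (@snd U V) t (fun y => scal y l) (@snd U V)); [exact H|].
  apply filterdiff_linear, is_linear_snd.
Qed.

Lemma solution_const {V : NormedModule R_AbsRing} (f : V -> V) (T : Rbar) (E : V) :
  is_equilibrium f E -> solution f T (fun _ => E).
Proof.
  intros HE. split.
  - apply filterlim_const.
  - intros t _ _. rewrite HE. apply (is_derive_const E t).
Qed.

(** A constant solution can only converge to its own value. *)
Lemma globally_attractive_equilibrium_unique {V : NormedModule R_AbsRing}
    (f : V -> V) (X : V -> Prop) (E E' : V) :
  globally_attractive f X E -> is_equilibrium f E' -> X E' -> E' = E.
Proof.
  intros H HE' HX.
  pose proof (H (fun _ => E') (solution_const f p_infty E' HE') HX) as Hc.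
  apply (filterlim_locally_unique (F := Rbar_locally p_infty) (fun _ => E'));
    [apply filterlim_const | exact Hc].
Qed.

(** * Local asymptotic stability of the radical-free equilibrium *)

(** A weighted sum of squares [K p ^ 2 + b ^ 2] is a strict Lyapunov function
    near 0 for a quadratic system with lower triangular linear part and negative
    diagonal entries [- m], [- k]. *)
Lemma triangular_quadratic_lyapunov (m k c beta e delta : R) :
  0 < m -> 0 < k -> 0 < beta -> 0 < delta ->
  exists K lam r : R, 1 <= K /\ 0 < lam /\ 0 < r /\
    forall p b, Rabs p < r -> Rabs b < r ->
      2 * K * p * (p * (- m - 2 * beta * p + e * b))
      + 2 * b * (- k * b - c * p - 2 * delta * p * b)
      <= - lam * (K * p ^ 2 + b ^ 2).
Proof.
  intros Hm Hk Hbeta Hdelta.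
  assert (Hq : 0 <= c ^ 2 / k) by (apply Rdiv_le_0_compat; nra).
  assert (Hq' : 0 <= c ^ 2 / k / m) by (apply Rdiv_le_0_compat; lra).
  pose proof (Rabs_pos e) as He.
  (* [K] is large enough for [K m p ^ 2] to absorb what completing the square
     in the cross term [- 2 c p b] leaves, namely [(c ^ 2 / k) p ^ 2]. *)
  set (K := c ^ 2 / k / m + 1).
  assert (HKm : c ^ 2 / k <= K * m).
  { unfold K. replace ((c ^ 2 / k / m + 1) * m) with (c ^ 2 / k + m)
      by (field; lra). lra. }
  assert (HK : 1 <= K) by (unfold K; lra).
  clearbody K.
  set (s := 2 * beta + Rabs e).
  assert (Hs : 0 < s) by (unfold s; lra).
  exists K, (Rmin m k / 2), (Rmin (m / (4 * s)) (k / (8 * delta))).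
  assert (Hr1 : 0 < m / (4 * s)) by (apply Rdiv_lt_0_compat; lra).
  assert (Hr2 : 0 < k / (8 * delta)) by (apply Rdiv_lt_0_compat; lra).
  assert (Hlam : 0 < Rmin m k) by (apply Rmin_glb_lt; lra).
  split; [exact HK|]. split; [lra|]. split; [now apply Rmin_glb_lt|].
  intros p b Hp Hb.
  assert (Hp1 : Rabs p < m / (4 * s)) by (eapply Rlt_le_trans; [exact Hp | apply Rmin_l]).
  assert (Hp2 : Rabs p < k / (8 * delta)) by (eapply Rlt_le_trans; [exact Hp | apply Rmin_r]).
  assert (Hb1 : Rabs b < m / (4 * s)) by (eapply Rlt_le_trans; [exact Hb | apply Rmin_l]).
  assert (Hpp : - 2 * beta * p + e * b <= m / 4).
  { replace (m / 4) with (2 * beta * (m / (4 * s)) + Rabs e * (m / (4 * s)))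
      by (unfold s; field; fold s; lra).
    pose proof (Rle_abs (- p)) as H1. rewrite Rabs_Ropp in H1.
    pose proof (Rle_abs (e * b)) as H2. rewrite Rabs_mult in H2.
    assert (Rabs e * Rabs b <= Rabs e * (m / (4 * s)))
      by (apply Rmult_le_compat_l; lra).
    nra. }
  assert (Hpb : - 4 * delta * p <= k / 2).
  { replace (k / 2) with (4 * delta * (k / (8 * delta))) by (field; lra).
    pose proof (Rle_abs (- p)) as H1. rewrite Rabs_Ropp in H1. nra. }
  assert (Hcross : - 2 * c * p * b <= k * b ^ 2 + c ^ 2 / k * p ^ 2).
  { assert (0 <= (k * b + c * p) ^ 2 / k)
      by (apply Rdiv_le_0_compat; [apply pow2_ge_0 | exact Hk]).
    replace ((k * b + c * p) ^ 2 / k)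
      with (k * b ^ 2 + 2 * c * p * b + c ^ 2 / k * p ^ 2) in H by (field; lra).
    lra. }
  pose proof (pow2_ge_0 p) as Hp0. pose proof (pow2_ge_0 b) as Hb0.
  assert (T1 : 2 * (K * p ^ 2) * (- 2 * beta * p + e * b) <= 2 * (K * p ^ 2) * (m / 4))
    by (apply Rmult_le_compat_l; nra).
  assert (T2 : b ^ 2 * (- 4 * delta * p) <= b ^ 2 * (k / 2))
    by (apply Rmult_le_compat_l; lra).
  assert (T3 : c ^ 2 / k * p ^ 2 <= K * m * p ^ 2)
    by (apply Rmult_le_compat_r; lra).
  assert (T4 : Rmin m k * (K * p ^ 2) <= m * (K * p ^ 2))
    by (apply Rmult_le_compat_r; [nra | apply Rmin_l]).
  assert (T5 : Rmin m k * b ^ 2 <= k * b ^ 2)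
    by (apply Rmult_le_compat_r; [lra | apply Rmin_r]).
  nra.
Qed.

Lemma Rabs_lt_of_sqr_lt (x r : R) : 0 < r -> x ^ 2 < r ^ 2 -> Rabs x < r.
Proof.
  intros Hr H.
  apply Rabs_def1; nra.
Qed.

(** Weighted squared distance to the point [(0, A0)]. *)
Definition weighted_dist (K A0 : R) (x : R * R) : R :=
  K * fst x ^ 2 + (snd x - A0) ^ 2.

Lemma weighted_dist_ge_0 (K A0 : R) (x : R * R) :
  0 <= K -> 0 <= weighted_dist K A0 x.
Proof.
  intros HK. unfold weighted_dist.
  pose proof (pow2_ge_0 (fst x)). pose proof (pow2_ge_0 (snd x - A0)). nra.
Qed.

Lemma weighted_dist_lt_ball (K A0 r : R) (Hr : 0 < r) (x : R * R) :
  1 <= K -> weighted_dist K A0 x < r ^ 2 ->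
  Rabs (fst x) < r /\ Rabs (snd x - A0) < r.
Proof.
  unfold weighted_dist. intros HK H.
  pose proof (pow2_ge_0 (fst x)). pose proof (pow2_ge_0 (snd x - A0)).
  split; apply Rabs_lt_of_sqr_lt; nra.
Qed.

Lemma ball_pair_iff (A0 : R) (eps : posreal) (x : R * R) :
  ball ((0, A0) : R * R) eps x <->
  Rabs (fst x) < eps /\ Rabs (snd x - A0) < eps.
Proof.
  destruct x as [p a].
  change (ball ((0, A0) : R * R) eps (p, a))
    with (Rabs (p - 0) < eps /\ Rabs (a - A0) < eps).
  rewrite Rminus_0_r. reflexivity.
Qed.

Lemma is_derive_weighted_squares (K A0 : R) (p a : R -> R) (t dp da : R) :
  is_derive p t dp -> is_derive a t da ->
  is_derive (fun s => K * p s ^ 2 + (a s - A0) ^ 2) t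
    (2 * K * p t * dp + 2 * (a t - A0) * da).
Proof.
  intros Hp Ha. auto_derive.
  - repeat split; eexists; eassumption.
  - change (Derive (fun s => p s)) with (Derive p).
    change (Derive (fun s => a s)) with (Derive a).
    rewrite (is_derive_unique p t dp Hp), (is_derive_unique a t da Ha). ring.
Qed.

(** Below the level [v0] the weighted squared distance to the radical-free
    equilibrium decays exponentially along every solution.  The estimate covers
    solutions on any horizon [T], so it gives both stability and attraction. *)
Lemma planar_field_lyapunov (mu delta eta rho beta : R) :
  0 < mu -> 0 < delta -> 0 < eta -> 0 < rho -> 0 < beta ->
  R_LA_sym mu delta eta rho beta < 1 ->
  exists K lam v0 : R, 1 <= K /\ 0 < lam /\ 0 < v0 /\
    forall (T : Rbar) (x : R -> R * R),
      solution (planar_field mu delta eta rho beta) T x ->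
      weighted_dist K (eta / (eta + rho)) (x 0) < v0 ->
      forall t, 0 <= t -> Rbar_lt t T ->
        weighted_dist K (eta / (eta + rho)) (x t)
        <= weighted_dist K (eta / (eta + rho)) (x 0) * exp (- lam * t).
Proof.
  intros Hmu Hdelta Heta Hrho Hbeta HR.
  set (A0 := eta / (eta + rho)).
  assert (HA0 : A0 * (eta + rho) = eta) by (unfold A0; field; lra).
  set (m := mu - beta - (delta - beta) * A0).
  assert (Hm : 0 < m).
  { unfold R_LA_sym in HR.
    assert (Hden : 0 < mu * (eta + rho)) by nra.
    apply Rlt_div_l in HR; [|exact Hden].
    assert (m * (eta + rho) = mu * (eta + rho) - (rho * beta + eta * delta)).
    { unfold m. rewrite Rmult_minus_distr_r, (Rmult_assoc (delta - beta)), HA0. ring. }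
    nra. }
  destruct (triangular_quadratic_lyapunov m (eta + rho) (2 * (eta + delta * A0))
              beta (delta - beta) delta) as (K & lam & r & HK & Hlam & Hr & Hdec);
    [lra.. |].
  exists K, lam, (r ^ 2). split; [exact HK|]. split; [exact Hlam|].
  split; [nra|].
  intros T x [Hc Hd] H0 t Ht HtT.
  set (dp := fun s => fst (planar_field mu delta eta rho beta (x s))).
  set (da := fun s => snd (planar_field mu delta eta rho beta (x s))).
  apply (sublevel_exponential_decay (fun s => weighted_dist K A0 (x s))
           (fun s => 2 * K * fst (x s) * dp s + 2 * (snd (x s) - A0) * da s)
           (r ^ 2) lam T); try assumption.
  - lra.
  - intros s. apply weighted_dist_ge_0. lra.
  - apply (filterlim_comp _ _ _ x (weighted_dist K A0) _ (locally (x 0)));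
      [exact Hc|].
    change (continuous (weighted_dist K A0) (x 0)).
    unfold weighted_dist.
    apply (continuous_plus (U := prod_UniformSpace R_UniformSpace R_UniformSpace) (V := R_NormedModule)).
    + apply (continuous_comp fst (fun p => K * p ^ 2)).
      * apply continuous_fst.
      * apply (ex_derive_continuous (fun p => K * p ^ 2)). auto_derive. exact I.
    + apply (continuous_comp snd (fun a => (a - A0) ^ 2)).
      * apply continuous_snd.
      * apply (ex_derive_continuous (fun a => (a - A0) ^ 2)). auto_derive. exact I.
  - intros s Hs HsT. specialize (Hd s Hs HsT).
    pose proof (is_derive_fst (U := R_NormedModule) (V := R_NormedModule) x s _ Hd) as Hp.
    pose proof (is_derive_snd (U := R_NormedModule) (V := R_NormedModule) x s _ Hd) as Ha.
    fold (dp s) in Hp. fold (da s) in Ha.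
    exact (is_derive_weighted_squares K A0 _ _ s _ _ Hp Ha).
  - intros s Hs HsT Hlt.
    destruct (weighted_dist_lt_ball K A0 r Hr (x s) HK Hlt) as [Hp Hb].
    specialize (Hdec _ _ Hp Hb).
    unfold dp, da, weighted_dist. destruct (x s) as [p a]; simpl in *.
    (* Translating [A = A0 + b] uses only [A0 (eta + rho) = eta]. *)
    assert (E : eta * (1 - 2 * p - a) - (2 * delta * p + rho) * a
      = - (eta + rho) * (a - A0) - 2 * (eta + delta * A0) * p
        - 2 * delta * p * (a - A0)).
    { transitivity (A0 * (eta + rho) - 2 * eta * p - (eta + rho) * a
                    - 2 * delta * p * a); [rewrite HA0 |]; ring. }
    rewrite E. unfold m in Hdec. eapply Rle_trans; [|exact Hdec].
    right. ring.
Qed.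

Lemma E0_sym_is_equilibrium (mu delta eta rho beta : R) :
  0 < eta + rho ->
  is_equilibrium (planar_field mu delta eta rho beta) (E0_sym eta rho).
Proof.
  intros H. unfold is_equilibrium, planar_field, E0_sym.
  apply injective_projections; simpl; unfold zero; simpl; [ring | field; lra].
Qed.

Lemma E0_sym_locally_asymptotically_stable (mu delta eta rho beta : R) :
  0 < mu -> 0 < delta -> 0 < eta -> 0 < rho -> 0 < beta ->
  R_LA_sym mu delta eta rho beta < 1 ->
  locally_asymptotically_stable
    (planar_field mu delta eta rho beta) (E0_sym eta rho).
Proof.
  intros Hmu Hdelta Heta Hrho Hbeta HR.
  destruct (planar_field_lyapunov mu delta eta rho beta)
    as (K & lam & v0 & HK & Hlam & Hv0 & Hdecay); try assumption.
  set (A0 := eta / (eta + rho)) in *.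
  assert (Hnear : forall v : R, 0 < v -> exists d : posreal, forall y : R * R,
            ball (E0_sym eta rho) d y -> weighted_dist K A0 y < v).
  { intros v Hv.
    assert (Hd : 0 < Rmin 1 (v / (K + 1))).
    { apply Rmin_glb_lt; [lra | apply Rdiv_lt_0_compat; lra]. }
    exists (mkposreal _ Hd). intros y Hy.
    apply ball_pair_iff in Hy; simpl in Hy; fold A0 in Hy. destruct Hy as [Hp Hb].
    set (d := Rmin 1 (v / (K + 1))) in *.
    assert (d <= 1) by apply Rmin_l.
    assert (Hdv : (K + 1) * d <= v).
    { replace v with ((K + 1) * (v / (K + 1))) by (field; lra).
      apply Rmult_le_compat_l; [lra | apply Rmin_r]. }
    apply Rabs_def2 in Hp. apply Rabs_def2 in Hb. unfold weighted_dist.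
    assert (fst y ^ 2 < d) by nra. assert ((snd y - A0) ^ 2 < d) by nra.
    nra. }
  assert (Hball : forall (eps : posreal) (y : R * R),
            weighted_dist K A0 y < eps ^ 2 -> ball (E0_sym eta rho) eps y).
  { intros eps y Hy. apply ball_pair_iff.
    apply (weighted_dist_lt_ball K); [apply cond_pos | exact HK | exact Hy]. }
  split; [apply E0_sym_is_equilibrium; lra|]. split.
  - intros eps.
    assert (He : 0 < eps ^ 2) by (apply pow_lt, cond_pos).
    destruct (Hnear (Rmin v0 (eps ^ 2))) as [d Hd]; [now apply Rmin_glb_lt|].
    exists d. intros T x Hx H0 t Ht HtT. apply Hball.
    apply Hd in H0.
    assert (H1 : weighted_dist K A0 (x 0) < v0)
      by (eapply Rlt_le_trans; [exact H0 | apply Rmin_l]).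
    assert (H2 : weighted_dist K A0 (x 0) < eps ^ 2)
      by (eapply Rlt_le_trans; [exact H0 | apply Rmin_r]).
    specialize (Hdecay T x Hx H1 t Ht HtT).
    assert (exp (- lam * t) <= 1).
    { rewrite <- exp_0. destruct (Rle_lt_or_eq_dec 0 t Ht) as [Ht0 | <-].
      - left. apply exp_increasing. nra.
      - rewrite Rmult_0_r. lra. }
    assert (0 <= weighted_dist K A0 (x 0))
      by (apply weighted_dist_ge_0; lra).
    nra.
  - destruct (Hnear v0 Hv0) as [d Hd]. exists d. intros x Hx H0.
    apply Hd in H0. apply filterlim_locally. intros eps.
    assert (He : 0 < eps ^ 2) by (apply pow_lt, cond_pos).
    assert (Hlim : is_lim (fun t => v0 * exp (- lam * t)) p_infty 0).
    { replace 0 with (v0 * 0) by ring.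
      apply (is_lim_scal_l (fun t => exp (- lam * t)) v0 p_infty 0).
      apply (is_lim_comp exp (fun t => - lam * t) p_infty 0 m_infty).
      - exact is_lim_exp_m.
      - replace m_infty with (Rbar_mult (- lam) p_infty).
        + apply (is_lim_scal_l (fun t => t) (- lam) p_infty p_infty), is_lim_id.
        + apply is_Rbar_mult_unique. apply is_Rbar_mult_sym, is_Rbar_mult_p_infty_neg.
          simpl. lra.
      - exists 0. intros y _. discriminate. }
    apply is_lim_spec in Hlim. destruct (Hlim (mkposreal _ He)) as [M HM].
    exists (Rmax M 0). intros t Ht. apply Hball.
    pose proof (Rmax_l M 0). pose proof (Rmax_r M 0).
    specialize (HM t ltac:(lra)). simpl in HM. apply Rabs_def2 in HM.
    specialize (Hdecay p_infty x Hx H0 t ltac:(lra) I).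
    pose proof (exp_pos (- lam * t)). nra.
Qed.

(** * The endemic equilibrium and the failure of global attraction *)

Lemma endemic_equilibrium_of_root (mu delta eta rho beta P : R) :
  0 < delta -> 0 < eta -> 0 < rho -> 0 < P < 1 / 2 ->
  Q mu delta eta rho beta P = 0 ->
  exists A : R, 0 <= A /\ 2 * P + A <= 1 /\
    is_equilibrium (planar_field mu delta eta rho beta) ((P, A) : R * R).
Proof.
  intros Hdelta Heta Hrho HP HQ.
  set (D := eta + rho + 2 * delta * P).
  assert (HD : 0 < D) by (unfold D; nra).
  set (A := eta * (1 - 2 * P) / D).
  assert (HA : A * D = eta * (1 - 2 * P)) by (unfold A; field; lra).
  assert (HA0 : 0 <= A) by (apply Rdiv_le_0_compat; [nra | exact HD]).
  exists A. split; [exact HA0|]. split.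
  - assert (A <= 1 - 2 * P); [|lra].
    apply (Rmult_le_reg_r D); [exact HD|]. rewrite HA.
    rewrite (Rmult_comm eta). apply Rmult_le_compat_l; [lra|]. unfold D. nra.
  - (* Multiplied by [D], the growth rate of [P] equals [- Q P]. *)
    assert (Hrate : (beta - mu) - 2 * beta * P + (delta - beta) * A = 0).
    { apply (Rmult_eq_reg_r D); [|lra].
      transitivity (((beta - mu) - 2 * beta * P) * D + (delta - beta) * (A * D));
        [ring|].
      rewrite HA. transitivity (- Q mu delta eta rho beta P);
        [unfold D, Q; ring | rewrite HQ; ring]. }
    unfold is_equilibrium, planar_field.
    apply injective_projections; simpl; unfold zero; simpl.
    + rewrite Hrate. ring.
    + transitivity (eta * (1 - 2 * P) - A * D); [unfold D; ring | rewrite HA; ring].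
Qed.

(** The diagonal [L = R = P] is invariant for the symmetric system, with
    [beta = alpha + gamma]. *)
Lemma symmetric_equilibrium_of_planar (mu delta eta rho alpha gamma P A : R) :
  is_equilibrium (planar_field mu delta eta rho (alpha + gamma)) ((P, A) : R * R) ->
  is_equilibrium (symmetric_field mu delta eta rho alpha gamma)
    ((P, P, A) : R * R * R).
Proof.
  unfold is_equilibrium, planar_field, symmetric_field. intros H.
  injection H as H1 H2.
  apply injective_projections; [apply injective_projections|].
  - etransitivity; [|exact H1]. simpl. ring.
  - etransitivity; [|exact H1]. simpl. ring.
  - etransitivity; [|exact H2]. simpl. ring.
Qed.

Lemma symmetric_not_globally_attractive (mu delta eta rho alpha gamma P : R) :
  0 < delta -> 0 < eta -> 0 < rho -> 0 < P < 1 / 2 ->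
  Q mu delta eta rho (alpha + gamma) P = 0 ->
  ~ exists E : R * R * R,
      globally_attractive (symmetric_field mu delta eta rho alpha gamma) simplex E.
Proof.
  intros Hdelta Heta Hrho HP HQ [E HE].
  destruct (endemic_equilibrium_of_root mu delta eta rho (alpha + gamma) P)
    as (A & HA & HPA & Heq); try assumption.
  assert (H1 : ((P, P, A) : R * R * R) = E).
  { apply (globally_attractive_equilibrium_unique _ simplex _ _ HE).
    - now apply symmetric_equilibrium_of_planar.
    - simpl. lra. }
  assert (HA0 : 0 <= eta / (eta + rho) <= 1).
  { split; [apply Rdiv_le_0_compat; lra|]. apply Rle_div_l; lra. }
  assert (H2 : ((0, 0, eta / (eta + rho)) : R * R * R) = E).
  { apply (globally_attractive_equilibrium_unique _ simplex _ _ HE).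
    - apply symmetric_equilibrium_of_planar, (E0_sym_is_equilibrium _ _ eta rho). lra.
    - simpl. lra. }
  rewrite <- H2 in H1. injection H1 as H1. lra.
Qed.

Theorem corollary3p4 :
  (forall mu delta eta rho alpha gamma beta : R,
     0 < mu -> 0 < delta -> 0 < eta -> 0 < rho -> 0 < alpha -> 0 < gamma ->
     beta = alpha + gamma ->
     R_LA_sym mu delta eta rho beta < 1 ->
     (exists P : R, 0 < P < 1 / 2 /\ Q mu delta eta rho beta P = 0) ->
     locally_asymptotically_stable
       (planar_field mu delta eta rho beta) (E0_sym eta rho) /\
     ~ globally_attractive
         (planar_field mu delta eta rho beta) planar_simplex (E0_sym eta rho) /\
     ~ (exists E : R * R * R,
          globally_attractive
            (symmetric_field mu delta eta rho alpha gamma) simplex E)) /\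
  ~ one_regime_classification.
Proof.
  split.
  - intros mu delta eta rho alpha gamma beta Hmu Hdelta Heta Hrho Halpha Hgamma
      -> HR (P & HP & HQ).
    split; [apply E0_sym_locally_asymptotically_stable; lra|]. split.
    + intros H.
      destruct (endemic_equilibrium_of_root mu delta eta rho (alpha + gamma) P)
        as (A & HA & HPA & Heq); try assumption.
      assert (HE : ((P, A) : R * R) = E0_sym eta rho).
      { apply (globally_attractive_equilibrium_unique _ planar_simplex _ _ H Heq).
        simpl. lra. }
      injection HE as HE. lra.
    + now apply (symmetric_not_globally_attractive _ _ _ _ _ _ P).
  - (* Here [R_LA_sym = 8 / 9] and [Q (1 / 4) = 0]. *)
    intros H.
    apply (symmetric_not_globally_attractive 1 (1 / 2) (2 / 5) (1 / 20) 2 2 (1 / 4));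
      [lra .. | unfold Q; lra |].
    apply H; try lra. unfold R_LA_sym. lra.
Qed.
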